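(* Let $G$ be a finite simple graph in which every vertex has degree at most $3$. Then for every maximal packing $S$ of $G$, there exists an independent dominating set of $G$ of size at most $3|S|$.
   Context: A set $A\subseteq V(G)$ is a dominating set of $G$ if every vertex of $G$ is in $A$ or adjacent to a vertex of $A$; an independent dominating set is a dominating set no two of whose vertices are adjacent. A packing of $G$ is a set $S\subseteq V(G)$ whose closed neighborhoods $N_G[v]=N_G(v)\cup\{v\}$, $v\in S$, are pairwise disjoint (equivalently, any two distinct vertices of $S$ are at distance at least $3$ in $G$). A maximal packing is a packing not properly contained in any other packing of $G$. *)

(* Defs.v *)
From mathcomp Require Import all_boot.

Set Implicit Arguments.
Unset Strict Implicit.
Unset Printing Implicit Defensive.

Section Graph.

Variables (V : finType) (e : rel V).

Definition simple_graph : Prop := symmetric e /\ irreflexive e.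

Definition nbhd (v : V) : {set V} := [set w | e v w].

Definition cl_nbhd (v : V) : {set V} := v |: nbhd v.

Definition degree (v : V) : nat := #|nbhd v|.

Definition dominating (A : {set V}) : bool :=
  [forall v, (v \in A) || [exists u in A, e v u]].

Definition independent (A : {set V}) : bool :=
  [forall u in A, forall v in A, ~~ e u v].

Definition packing (S : {set V}) : bool :=
  [forall u in S, forall v in S,
    (u != v) ==> [disjoint cl_nbhd u & cl_nbhd v]].

Definition maximal_packing (S : {set V}) : bool := maxset packing S.

End Graph.

(* Main.v *)
Require Import Defs.
From mathcomp Require Import all_boot.

(** Let [X] be the neighbourhood of [S] and call the vertices outside [S] and
    [X] remote; by maximality every remote vertex has a neighbour in [X].  Call
    [s \in S] full if it has three neighbours, each with a remote neighbour.
    The neighbours of the full vertices induce a graph of maximum degree 1, so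
    some independent set [T] of them meets [N(s)] for every full [s].  Extend
    [T] to a maximal independent subset [I] of [X], and [I] to a maximal
    independent set [A].  A vertex of [X] outside [I] has a neighbour in [S] and
    one in [I], hence at most one remote neighbour in [A]; so sending each
    remote vertex of [A] to a neighbour in [X] is injective, with values outside
    [I].  Charging these vertices, and those of [I], to the vertex of [S] they
    are adjacent to, each [s] receives at most [#|N(s)| <= 3], and at most 2 if
    [s \in A], because then [N(s)] misses [I] and [s] is not full. *)

Section Graph.

Variables (V : finType) (e : rel V).

(** * Independent sets and transversals *)

Lemma independentP (A : {set V}) :
  reflect {in A &, forall u v, ~~ e u v} (independent e A).
Proof.
apply: (iffP forall_inP) => [h u v uA vA | h u uA].
  by have /forall_inP := h u uA; apply.
by apply/forall_inP => v vA; apply: h.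
Qed.

Lemma uniq_nbrs_leq_degree (v : V) (r : seq V) :
  uniq r -> all (e v) r -> size r <= degree e v.
Proof.
move=> ur /allP er; rewrite -(card_uniqP ur); apply/subset_leq_card/subsetP.
by move=> w /er; rewrite inE.
Qed.

(* Allowing one class [B r] to be a singleton makes the induction work: pick a
   vertex there and delete its only neighbour, which shrinks one class only. *)
Lemma independent_transversal_matching (Y D : {set V}) (B : V -> {set V})
    (r : option V) :
  symmetric e -> irreflexive e ->
  {in Y & Y & Y, forall v u w, e v u -> e v w -> u = w} ->
  {in D, forall s, B s \subset Y} ->
  {in D &, forall s t, s != t -> [disjoint B s & B t]} ->
  {in D, forall s, (Some s != r) < #|B s|} ->
  exists T : {set V}, [/\ independent e T, T \subset \bigcup_(s in D) B s &
    {in D, forall s, T :&: B s != set0}].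
Proof.
move=> esym eirr matchY.
elim: {D}_.+1 {-2}D (ltnSn #|D|) B r => // n IHn D ltDn B r subB disB cardB.
have [-> | [r1 r1D]] := set_0Vmem D.
  exists set0; split; last by move=> s; rewrite inE.
  - by apply/independentP => u v; rewrite inE.
  - exact: sub0set.
(* The possibly short class is treated first if it is present, so every other class has at least two
   vertices. *)
pose q := if r is Some s then if s \in D then s else r1 else r1.
have qD : q \in D by rewrite /q; case: (r) => // s; case: ifP.
have cardBq s : s \in D -> s != q -> 1 < #|B s|.
  move=> sD; have := cardB s sD; rewrite /q.
  case: (r) => [t|] //=; case: ifP => [_ | tD] ltB nst.
    by move: ltB; rewrite (inj_eq Some_inj) nst.
  by move: ltB; case: eqP => // -[st]; rewrite -st sD in tD.
have /card_gt0P[a aB] : 0 < #|B q| by apply: leq_trans (cardB q qD).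
have aY : a \in Y by apply: (subsetP (subB q qD)).
pose D' := D :\ q; pose B' s := B s :\: nbhd e a.
have D'D s : s \in D' -> s \in D by rewrite inE => /andP[].
have D'q s : s \in D' -> s != q by rewrite !inE => /andP[].
pose hit s := (s \in D') && (B s :&: nbhd e a != set0).
(* By [matchY] and disjointness at most one class loses a vertex to the deletion, and only one; it
   becomes the exceptional class of the recursive call. *)
pose r' := [pick s | hit s].
have ltD' : #|D'| < n.
  by move: ltDn; rewrite (cardsD1 q) qD.
have [||| T [indT subT hitT]] := IHn D' ltD' B' r'.
- by move=> s /D'D sD; apply: subset_trans (subB s sD); apply: subsetDl.
- move=> s t /D'D sD /D'D tD nst.
  apply: disjointWl (subsetDl _ _) _; apply: disjointWr (subsetDl _ _) _.
  exact: disB.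
- move=> s sD'; have sD := D'D s sD'; have lt1 := cardBq s sD (D'q s sD').
  rewrite /B' cardsD.
  have [h0 | h0] := eqVneq (B s :&: nbhd e a) set0.
    by rewrite h0 cards0 subn0; case: (Some s != r') => //; apply: ltnW.
  have le1 : #|B s :&: nbhd e a| <= 1.
    apply/card_le1_eqP => u w; rewrite !inE => /andP[uB au] /andP[wB aw].
    by apply: (matchY a) => //; apply: (subsetP (subB s sD)).
  suff -> : (Some s != r') = false.
    by rewrite subn_gt0; apply: leq_ltn_trans lt1.
  apply/negbF/eqP.
  rewrite /r'; case: pickP => [t /andP[tD' /set0Pn[u]] | /(_ s)]; last first.
    by rewrite /hit sD' h0.
  case/set0Pn: h0 => w; rewrite !inE => /andP[wB aw] /andP[uB au] /=.
  congr Some; apply/eqP/negPn/negP => nst.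
  have tD := D'D t tD'.
  have uw : u = w.
    by apply: (matchY a) => //; [apply: (subsetP (subB t tD))|
      apply: (subsetP (subB s sD))].
  have /disjointFr := disB s t sD tD nst.
  by move=> /(_ w wB); rewrite -uw uB.
have naT u : u \in T -> ~~ e a u.
  by move=> /(subsetP subT)/bigcupP[s _]; rewrite !inE => /andP[].
exists (a |: T); split.
- apply/independentP => u v /setU1P[->|uT] /setU1P[->|vT].
  + by rewrite eirr.
  + exact: naT.
  + by rewrite esym naT.
  + by have /independentP := indT; apply.
- rewrite subUset sub1set; apply/andP; split; first by apply/bigcupP; exists q.
  apply: subset_trans subT _; apply/bigcupsP => s /D'D sD.
  by apply: subset_trans (subsetDl _ _) _; apply: bigcup_sup.
- move=> s sD; have [-> | nsq] := eqVneq s q.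
    by apply/set0Pn; exists a; rewrite !inE eqxx.
  have sD' : s \in D' by rewrite !inE nsq.
  have /set0Pn[u] := hitT s sD'; rewrite !inE => /andP[uT /andP[_ uB]].
  by apply/set0Pn; exists u; rewrite !inE uT uB orbT.
Qed.

(** Serves twice: for [I] inside the neighbourhood of the packing, and for [A] inside [setT], where
    the last clause gives domination. *)
Lemma maximal_independent_in (X T : {set V}) :
  symmetric e -> irreflexive e -> independent e T -> T \subset X ->
  exists I : {set V}, [/\ independent e I, T \subset I, I \subset X &
    {in X, forall v, v \notin I -> exists2 u, u \in I & e v u}].
Proof.
move=> esym eirr indT TX.
pose P := [pred I : {set V} | independent e I && (I \subset X)].
have [|I /maxsetP[/andP[indI IX] maxI] TI] := @maxset_exists _ P T.
  by rewrite /= indT.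
exists I; split=> // v vX vI; apply/exists_inP; apply: contraT => nv.
have nvI u : u \in I -> ~~ e v u.
  by move=> uI; apply: contra nv => evu; apply/exists_inP; exists u.
case/negP: vI; rewrite -(maxI (v |: I)) ?setU11 ?subsetUr //=.
rewrite subUset sub1set vX IX !andbT.
apply/independentP => u w /setU1P[->|uI] /setU1P[->|wI].
- by rewrite eirr.
- exact: nvI.
- by rewrite esym nvI.
- by have /independentP := indI; apply.
Qed.

(** * Maximal packings and a union bound *)

Lemma packing_disjoint (S : {set V}) : packing e S ->
  {in S &, forall s t, s != t -> [disjoint cl_nbhd e s & cl_nbhd e t]}.
Proof.
move=> /forall_inP pS s t sS tS.
by have /forall_inP/(_ t tS)/implyP := pS s sS.
Qed.

(** Otherwise [v |: S] would be a larger packing. *)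
Lemma maximal_packing_near (S : {set V}) (v : V) :
  maximal_packing e S -> v \notin S ->
  exists2 s, s \in S & ~~ [disjoint cl_nbhd e v & cl_nbhd e s].
Proof.
move=> /maxsetP[pS maxS] vS; apply/exists_inP; apply: contraT => nv.
have dv s : s \in S -> [disjoint cl_nbhd e v & cl_nbhd e s].
  by move=> sS; apply: contraR nv => ?; apply/exists_inP; exists s.
case/negP: vS; rewrite -(maxS (v |: S)) ?setU11 ?subsetUr //.
apply/forall_inP => s sS; apply/forall_inP => t tS; apply/implyP.
case/setU1P: sS tS => [->|sS] /setU1P[->|tS]; rewrite ?eqxx // => nst.
- exact: dv.
- by rewrite disjoint_sym dv.
- exact: (packing_disjoint _ pS).
Qed.

Lemma leq_card_bigcup_sum (S Z : {set V}) (B : V -> {set V}) :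
  Z \subset \bigcup_(s in S) B s -> #|Z| <= \sum_(s in S) #|Z :&: B s|.
Proof.
move=> /subsetP sZ.
have sZ' : Z \subset \bigcup_(s in S) (Z :&: B s).
  apply/subsetP => z zZ; have /bigcupP[s sS zB] := sZ z zZ.
  by apply/bigcupP; exists s; rewrite // inE zZ.
apply: leq_trans (subset_leq_card sZ') _.
apply: (big_ind2 (fun (A : {set V}) n => #|A| <= n)); rewrite ?cards0 //.
move=> A m C n Am Cn; apply: leq_trans (leq_add Am Cn).
exact: leq_card_setU.
Qed.

End Graph.

(** * The bound for maximum degree 3 *)

Theorem theorem1 (V : finType) (e : rel V) (S : {set V}) :
  simple_graph e ->
  (forall v : V, degree e v <= 3) ->
  maximal_packing e S ->
  exists A : {set V},
    [/\ independent e A, dominating e A & #|A| <= 3 * #|S|].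
Proof.
move=> [esym eirr] deg3 maxS; have /maxsetP[pS _] := maxS.
pose X := \bigcup_(s in S) nbhd e s.
have disN s t : s \in S -> t \in S -> s != t -> [disjoint nbhd e s & nbhd e t].
  move=> sS tS nst; have := packing_disjoint _ _ _ pS s t sS tS nst.
  by move/(disjointWl (subsetUr _ _))/(disjointWr (subsetUr _ _)).
have XS v : v \in X -> v \notin S.
  move=> /bigcupP[s sS]; rewrite inE => esv; apply/negP => vS.
  have nsv : s != v by apply: contraL esv => /eqP->; rewrite eirr.
  have /disjointFr/(_ (_ : v \in _)) := packing_disjoint _ _ _ pS s v sS vS nsv.
  by rewrite !inE esv eqxx orbT => /(_ isT).
pose N := ~: (S :|: X).
have nbrX v : v \in N -> exists2 x, x \in X & e v x.
  rewrite !inE negb_or => /andP[vS vX].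
  (* Of the four ways for the closed neighbourhoods to meet in [w], three put [v] in [S] or [X]; in
     the last, [w] is the wanted neighbour. *)
  have [s sS /pred0Pn[w /andP[]]] := maximal_packing_near _ _ _ _ maxS vS.
  rewrite /= !inE => /orP[/eqP-> | evw] /orP[/eqP ws | esw].
  - by rewrite ws sS in vS.
  - by case/negP: vX; apply/bigcupP; exists s; rewrite ?inE.
  - case/negP: vX; apply/bigcupP; exists s; rewrite ?inE //.
    by rewrite -ws esym.
  - by exists w => //; apply/bigcupP; exists s; rewrite ?inE.
(* The remote vertices form [N]; the predicate [remote] says instead that a vertex has a neighbour
   in [N]. [F] is the set of full vertices. *)
pose remote v := [exists u in N, e v u].
pose F := [set s in S | (degree e s == 3) && [forall v in nbhd e s, remote v]].
pose Y := \bigcup_(s in F) nbhd e s.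
have YX : Y \subset X.
  apply/bigcupsP => s; rewrite inE => /andP[sS _].
  exact: (bigcup_sup s).
have NSX u : u \in N -> (u \notin S) && (u \notin X) by rewrite !inE negb_or.
have neqS s v : s \in S -> v \notin S -> s != v.
  by move=> sS; apply: contraNneq => <-.
have neqX v x : v \notin X -> x \in X -> x != v.
  by move=> vX; apply: contraTneq => ->.
(* Applied below to lists of four distinct neighbours, giving the contradiction [4 <= 3]. *)
have xdeg v r : uniq r -> all (e v) r -> size r <= 3.
  by move=> ur er; apply: leq_trans (deg3 v); apply: uniq_nbrs_leq_degree.
(* Every class has three vertices, so none is exceptional and [r] is [None]. *)
have [||||T [indT subT hitT]] :=
    independent_transversal_matching _ e Y F (nbhd e) None esym eirr.
- move=> v u w vY uY wY evu evw; apply/eqP/negPn/negP => nuw.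
  have uX := subsetP YX u uY; have wX := subsetP YX w wY.
  have /bigcupP[s] := vY; rewrite inE => /and3P[sS _ /forall_inP rs] vs.
  have /exists_inP[n nN evn] := rs v vs; have /andP[nS nX] := NSX n nN.
  have : size [:: s; n; u; w] <= 3.
    apply: (xdeg v); rewrite /= ?inE ?negb_or ?nuw ?evu ?evw ?evn ?andbT.
      have uS := XS u uX; have wS := XS w wX.
      by rewrite !(neqS _ _ sS) // !(eq_sym n) !(neqX n).
    by move: vs; rewrite inE esym.
  by [].
- by move=> s sF; apply: (bigcup_sup s).
- by move=> s t; rewrite !inE => /andP[sS _] /andP[tS _]; apply: disN.
- by move=> s; rewrite inE => /and3P[_ /eqP ds _]; rewrite -/(degree e s) ds.
have TX := subset_trans subT YX.
have [I [indI TI IX maxI]] := maximal_independent_in _ _ X T esym eirr indT TX.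
have [A [indA IA _ maxA]] :=
  maximal_independent_in _ _ setT I esym eirr indI (subsetT _).
have eA u v : u \in A -> v \in A -> e u v = false.
  by move=> uA vA; have /independentP/(_ u v uA vA)/negbTE := indA.
have AXI v : v \in A -> v \in X -> v \in I.
  move=> vA vX; apply: contraT => /(maxI v vX)[u uI].
  by rewrite eA // (subsetP IA).
exists A; split=> //.
  apply/forallP => v; apply/orP; have [vA|vA] := boolP (v \in A); first by left.
  right; have [u uA evu] := maxA v (in_setT _) vA.
  by apply/exists_inP; exists u.
pose J := A :&: N.
(* The default is never taken on [J], by [nbrX]. *)
pose phi j := odflt j [pick x in X | e j x].
have phiP j : j \in J -> (phi j \in X) && e j (phi j).
  rewrite inE => /andP[_ /nbrX[x xX ejx]]; rewrite /phi.
  by case: pickP => [y // | /(_ x)]; rewrite xX ejx.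
have phiA j : j \in J -> phi j \notin A.
  move=> jJ; apply/negP => pA; have /andP[_] := phiP j jJ.
  by rewrite eA //; move: jJ; rewrite inE => /andP[].
have phi_inj : {in J &, injective phi}.
  move=> j k jJ kJ ejk; apply/eqP/negPn/negP => njk.
  have /andP[pX ejp] := phiP j jJ; have /andP[_ ekp] := phiP k kJ.
  rewrite -ejk in ekp.
  have pI : phi j \notin I by apply: contra (phiA j jJ); apply: (subsetP IA).
  have [i iI epi] := maxI _ pX pI; have iX := subsetP IX i iI.
  have /bigcupP[s sS esp] := pX; rewrite inE in esp.
  move: (jJ) (kJ); rewrite ![_ \in J]inE.
  move=> /andP[_ /NSX/andP[jS jX]] /andP[_ /NSX/andP[kS kX]].
  (* If [phi] identified [j] and [k], the vertex [phi j] would have these four neighbours. *)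
  have : size [:: s; i; j; k] <= 3.
    apply: (xdeg (phi j)); last first.
      by rewrite /= !(esym (phi j)) esp esym epi ejp ekp.
    have iS := XS i iX.
    by rewrite /= !inE !negb_or !(neqS _ _ sS) // !(neqX _ i) // njk.
  by [].
pose Z := I :|: phi @: J.
have ZX : Z \subset X.
  rewrite subUset IX; apply/subsetP => _ /imsetP[j jJ ->].
  by have /andP[] := phiP j jJ.
have cardZ : #|Z| = #|I| + #|J|.
  rewrite cardsU (card_in_imset phi_inj) [I :&: _](_ : _ = set0) ?cards0 ?subn0 //.
  apply/setP => z; rewrite !inE; apply/negP => /andP[zI /imsetP[j jJ zj]].
  by move: (phiA j jJ); rewrite -zj (subsetP IA).
have cardA : #|A| <= #|A :&: S| + #|Z|.
  rewrite cardZ addnA; have sA : A \subset (A :&: S :|: I) :|: J.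
    apply/subsetP => v vA; rewrite !inE vA /=; case: (v \in S) => //=.
    by have [/(AXI v vA)->|] := boolP (v \in X); rewrite ?orbT.
  apply: leq_trans (subset_leq_card sA) _.
  apply: leq_trans (leq_card_setU _ _) _.
  by rewrite leq_add2r; apply: leq_card_setU.
apply: leq_trans cardA _; rewrite mulnC -sum_nat_const.
(* The charge of [s] is 1 if [s] lies in [A], plus the size of [Z :&: nbhd e s]. *)
have -> : #|A :&: S| = \sum_(s in S) (s \in A).
  by rewrite -sum1_card big_mkcond [RHS]big_mkcond; apply: eq_bigr => s _;
    rewrite inE; do 2!case: (_ \in _).
apply: leq_trans (leq_add (leqnn _) (leq_card_bigcup_sum _ _ _ _ ZX)) _.
rewrite -big_split /=; apply: leq_sum => s sS.
have leZ : #|Z :&: nbhd e s| <= 3.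
  exact: leq_trans (subset_leq_card (subsetIr _ _)) (deg3 s).
have [sA | //] := boolP (s \in A).
(* With three charged neighbours, none of them in [I], all are values of [phi]; then [s] is full and
   [T], a subset of [I], meets its neighbourhood. *)
rewrite ltn_neqAle leZ andbT; apply/negP => /eqP cardZs.
have nI v : v \in nbhd e s -> v \notin I.
  by rewrite inE => esv; apply/negP => /(subsetP IA) vA; rewrite eA in esv.
have eqZ : Z :&: nbhd e s = nbhd e s.
  by apply/eqP; rewrite eqEcard subsetIr cardZs; apply: deg3.
have sF : s \in F.
  rewrite inE sS /degree -eqZ cardZs /=; apply/forall_inP => v.
  rewrite !inE => /andP[/orP[vI|/imsetP[j jJ ->]] esv].
    by have := nI v; rewrite inE esv vI => /(_ isT).
  have /andP[_ ejp] := phiP j jJ.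
  apply/exists_inP; exists j; rewrite 1?esym //.
  by move: jJ; rewrite inE => /andP[].
have /set0Pn[v] := hitT s sF; rewrite inE => /andP[vT /nI].
by rewrite (subsetP TI).
Qed.
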